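(* Let a (function-free, range-restricted) logic program $P$, containing a goal rule, and a database $D$ be given. Every computed answer $\mathit{answer}(c_1,\ldots,c_m)$ (i.e. every fact $\mathit{answer}(c_1,\ldots,c_m)$ contained in the last state $S_n$ of some state sequence $S_1,\ldots,S_n$ whose first state $S_1$ is the initial state) is a logical consequence of $P\cup D$.
   Context: Setting (function-free Datalog). A rule is a formula $A\leftarrow B_1\wedge\dots\wedge B_n$ with $A,B_i$ atoms $p(t_1,\ldots,t_m)$ whose terms are variables or constants (no function symbols); $A$ is the head, $B_1\wedge\dots\wedge B_n$ the body. A fact is a rule with empty body and no variables. Every rule is range restricted: each variable of the head occurs in the body. Predicates are partitioned into EDB predicates (defined by facts) and IDB predicates (defined by rules). A program is a finite set of rules, each with an IDB predicate in the head and at least one body literal; a database is a finite set of facts with EDB predicates. A distinguished IDB predicate $\mathit{answer}$ does not occur in any rule body; a rule with head predicate $\mathit{answer}$ is a goal rule (the query). Normalization: the variables of a rule, ordered by first occurrence, are renamed to $X_0,X_1,\ldots$ in that order. A state is a set of normalized rules. In every rule with nonempty body the selected literal is the leftmost body literal. Instantiation: if $K\leftarrow L_1\wedge\dots\wedge L_m$ ($m>0$) is a rule in the state and $R$ is a program rule, rename the variables of $R$ apart to get $R'=A'\leftarrow B'_1\wedge\dots\wedge B'_n$; if $L_1$ and $A'$ unify with most general unifier $\sigma$, then $\sigma(R')$ is an instance of $R$. Reduction: if $A\leftarrow B_1\wedge\dots\wedge B_n$ is a derived rule and $F$ is a fact (from the database or the state) such that $B_1$ and $F$ unify with mgu $\sigma$,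 then $\sigma(A\leftarrow B_2\wedge\dots\wedge B_n)$ is a reduct ($F$ reduces the rule). Derived rules are normalized before being added to a state. Initial state: the goal rule together with all rules obtainable from it iteratively by instantiation. Dependency: a rule $R$ depends directly on $R'$ iff the selected literal of $R$ unifies with the head of $R'$; $R$ depends on $R'$ with respect to a state $S$ iff there are $R_1,\ldots,R_n\in S$ with $R_1=R$, each $R_i$ depending directly on $R_{i+1}$, and $R_n$ depending directly on $R'$ ($R'$ need not be in $S$). Successor state: given $P$, $D$, a state $S$ and a fact $F\in D$, the successor $S'$ is built by: (1) initialize $S'$ with all reducts of rules in $S$ by $F$; if this is empty, there is no successor state; (2) if $S'$ contains IDB facts, repeatedly apply reduction to rules in $S$ with facts in $S'$, inserting the results into $S'$, until nothing changes; (3) iteratively apply instantiation to each rule of $S'$ whose selected literal is an IDB literal, adding all instances to $S'$; (4) copy into $S'$ every rule of $S$ that depends (with respect to $S$) on a rule of $S'$ having at least one body literal. A state sequence is $S_1,\ldots,S_n$ where each $S_{i+1}$ is the successor state of $S_i$ for some fact $F_i\in D$. A fact $\mathit{answer}(c_1,\ldots,c_m)$ is computed if there is a state sequence $S_1,\ldots,S_n$ with $S_1$ the initial state and $\mathit{answer}(c_1,\ldots,c_m)\in S_n$. *)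

(* Defs.v *)
From mathcomp Require Import all_boot.
From mathcomp Require Import classical_sets cardinality.
From Stdlib Require List.

Set Implicit Arguments.
Unset Strict Implicit.
Unset Printing Implicit Defensive.

Local Open Scope classical_set_scope.

(* [idb p] says that [p] is an IDB predicate, otherwise it is an EDB one. *)
Record signature := Signature {
  psym : Type;
  csym : Type;
  arity : psym -> nat;
  idb : psym -> bool;
  answer : psym;
  answer_idb : idb answer }.

Section Syntax.
Variable Sg : signature.

(* The variable X_i is [Var i]. *)
Inductive term := Var of nat | Cst of csym Sg.

Record atom := Atom { apred : psym Sg; aargs : (arity apred).-tuple term }.

Record rule := Rule { rhead : atom; rbody : seq atom }.

Definition avars (A : atom) : seq nat :=
  pmap (fun t => if t is Var x then Some x else None) (aargs A).

Definition bvars (Bs : seq atom) : seq nat := flatten (map avars Bs).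

Definition rvars (R : rule) : seq nat := avars (rhead R) ++ bvars (rbody R).

Definition fact (R : rule) : Prop := rbody R = [::] /\ rvars R = [::].

Definition range_restricted (R : rule) : Prop :=
  {subset avars (rhead R) <= bvars (rbody R)}.

Definition goal_rule (R : rule) : Prop := apred (rhead R) = answer Sg.

Record program (P : set rule) : Prop := Program {
  program_finite : finite_set P;
  program_range_restricted : forall R, P R -> range_restricted R;
  program_head_idb : forall R, P R -> idb (apred (rhead R));
  program_body_nonempty : forall R, P R -> rbody R <> [::];
  program_answer : forall R B,
    P R -> List.In B (rbody R) -> apred B <> answer Sg }.

Record database (D : set rule) : Prop := Database {
  database_finite : finite_set D;
  database_fact : forall F, D F -> fact F;
  database_edb : forall F, D F -> ~~ idb (apred (rhead F)) }.

Definition answer_fact (c : (arity (answer Sg)).-tuple (csym Sg)) : rule :=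
  Rule (Atom (map_tuple Cst c)) [::].

Definition subst := nat -> term.

Definition tsubst (s : subst) (t : term) : term :=
  if t is Var x then s x else t.

Definition asubst (s : subst) (A : atom) : atom :=
  Atom (map_tuple (tsubst s) (aargs A)).

Definition rsubst (s : subst) (R : rule) : rule :=
  Rule (asubst s (rhead R)) (map (asubst s) (rbody R)).

Definition rrename (r : nat -> nat) (R : rule) : rule :=
  rsubst (fun x => Var (r x)) R.

Definition unifier (s : subst) (A B : atom) : Prop := asubst s A = asubst s B.

Definition mgu (s : subst) (A B : atom) : Prop :=
  unifier s A B /\
  forall u, unifier u A B -> exists w : subst, forall x, u x = tsubst w (s x).

(* [undup] keeps the last occurrence of each item, whence the two [rev]. *)
Definition first_occ (s : seq nat) : seq nat := rev (undup (rev s)).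

Definition normalize (R : rule) : rule :=
  rrename (fun x => index x (first_occ (rvars R))) R.

Definition variant_apart (Q R R' : rule) : Prop :=
  exists r : nat -> nat,
    [/\ injective r, R' = rrename r R
      & forall x, x \in rvars Q -> x \notin rvars R'].

(* [I] is an instance of the program rule [R], obtained from the selected
   literal of [Q]. *)
Definition instance (Q R I : rule) : Prop :=
  exists L Ls R' s,
    [/\ rbody Q = L :: Ls, variant_apart Q R R', mgu s L (rhead R')
      & I = rsubst s R'].

Definition reduct (Q F Q' : rule) : Prop :=
  fact F /\
  exists B Bs s,
    [/\ rbody Q = B :: Bs, mgu s B (rhead F)
      & Q' = rsubst s (Rule (rhead Q) Bs)].

Definition state := set rule.

(* Closure of [S] under instantiation by program rules, applied to those of
   its rules that belong to [W]. *)
Inductive inst_closure (P : set rule) (W : set rule) (S : state) : state :=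
| inst_base Q : S Q -> inst_closure P W S Q
| inst_step Q R I : inst_closure P W S Q -> W Q -> P R -> instance Q R I ->
    inst_closure P W S (normalize I).

Definition initial_state (P : set rule) (G : rule) : state :=
  inst_closure P setT [set normalize G].

Definition directly_depends (R R' : rule) : Prop :=
  exists L Ls R'' s,
    [/\ rbody R = L :: Ls, variant_apart R R' R'' & unifier s L (rhead R'')].

Inductive depends (S : state) : rule -> rule -> Prop :=
| depends_one R R' : S R -> directly_depends R R' -> depends S R R'
| depends_more R R1 R' : S R -> directly_depends R R1 -> depends S R1 R' ->
    depends S R R'.

Definition reducts_by (S : state) (F : rule) : state :=
  [set normalize Q' | Q' in [set Q' | exists2 Q, S Q & reduct Q F Q']].

Definition idb_fact (R : rule) : Prop := fact R /\ idb (apred (rhead R)).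

Inductive red_closure (S S1 : state) : state :=
| red_base Q : S1 Q -> red_closure S S1 Q
| red_step Q F Q' : (exists F0, S1 F0 /\ idb_fact F0) ->
    S Q -> red_closure S S1 F -> reduct Q F Q' ->
    red_closure S S1 (normalize Q').

Definition selects_idb (R : rule) : Prop :=
  if rbody R is L :: _ then idb (apred L) else False.

Definition copied (S S3 : state) : state :=
  [set Q | S Q /\ exists Q', [/\ S3 Q', rbody Q' <> [::] & depends S Q Q']].

Definition successor (P : set rule) (S : state) (F : rule) (S' : state) : Prop :=
  let S1 := reducts_by S F in
  let S2 := red_closure S S1 in
  let S3 := inst_closure P selects_idb S2 in
  S1 !=set0 /\ S' = S3 `|` copied S S3.

Definition state_sequence (P D : set rule) (ss : seq state) : Prop :=
  forall i, i.+1 < size ss ->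
    exists2 F, D F & successor P (nth set0 ss i) F (nth set0 ss i.+1).

Definition computed (P D : set rule) (G F : rule) : Prop :=
  exists ss : seq state,
    state_sequence P D (initial_state P G :: ss) /\
    last (initial_state P G) ss F.

Record structure := Structure {
  dom : Type;
  dom_inhabited : inhabited dom;
  cinterp : csym Sg -> dom;
  pinterp : forall p : psym Sg, (arity p).-tuple dom -> Prop }.

Definition teval (M : structure) (v : nat -> dom M) (t : term) : dom M :=
  match t with Var x => v x | Cst c => cinterp M c end.

Definition holds (M : structure) (v : nat -> dom M) (A : atom) : Prop :=
  pinterp (map_tuple (teval v) (aargs A)).

(* Rules are read as universally closed implications. *)
Definition satisfies (M : structure) (R : rule) : Prop :=
  forall v : nat -> dom M, List.Forall (holds v) (rbody R) -> holds v (rhead R).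

Definition logical_consequence (T : set rule) (R : rule) : Prop :=
  forall M : structure, (forall R', T R' -> satisfies M R') -> satisfies M R.

End Syntax.

(* Main.v *)
Require Import Defs.
From mathcomp Require Import all_boot.
From mathcomp Require Import classical_sets.

(** Every model of the program and the database satisfies all rules of all
    states: satisfaction is preserved by substitution, hence by normalization
    and instantiation, and a reduct is a resolvent of two satisfied rules.  *)

Local Open Scope classical_set_scope.

Section Soundness.
Context {Sg : signature} (M : structure Sg).
Implicit Types (v : nat -> dom M) (s : subst Sg) (P D S : set (rule Sg)).

Lemma teval_tsubst v s t :
  teval v (tsubst s t) = teval (fun x => teval v (s x)) t.
Proof. by case: t. Qed.

Lemma holds_asubst v s A :
  holds v (asubst s A) <-> holds (fun x => teval v (s x)) A.
Proof.
rewrite /holds /=; set t1 := map_tuple _ _; set t2 := map_tuple _ _.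
suff -> : t1 = t2 by [].
by apply: eq_from_tnth => i; rewrite !tnth_map teval_tsubst.
Qed.

(** Rules are universally closed, so [R] can be evaluated at the valuation [v] composed with [s]. *)
Lemma satisfies_rsubst s R : satisfies M R -> satisfies M (rsubst s R).
Proof.
move=> MR v /List.Forall_map Mbody; apply/holds_asubst/MR.
by apply: List.Forall_impl Mbody => A /holds_asubst.
Qed.

Lemma satisfies_normalize R : satisfies M R -> satisfies M (normalize R).
Proof. exact: satisfies_rsubst. Qed.

(** An instance is the program rule after two substitutions: the renaming apart, then the mgu. *)
Lemma satisfies_instance Q R I :
  instance Q R I -> satisfies M R -> satisfies M I.
Proof.
by move=> [L [Ls [R' [s [_ [r [_ -> _]] _ ->]]]]] MR; do 2!apply: satisfies_rsubst.
Qed.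

Lemma satisfies_reduct Q F Q' :
  reduct Q F Q' -> satisfies M Q -> satisfies M F -> satisfies M Q'.
Proof.
move=> [[Fbody _] [B [Bs [s [Qbody [BF _] ->]]]]] MQ MF v /= Mbody.
apply/holds_asubst/MQ; rewrite Qbody; constructor.
  (* The selected literal becomes an instance of the head of [F], which holds because the body of
     [F] is empty. *)
  apply/holds_asubst; rewrite BF; apply/holds_asubst/MF.
  by rewrite Fbody; constructor.
by move/List.Forall_map: Mbody; apply: List.Forall_impl => A /holds_asubst.
Qed.

Lemma inst_closure_sound P W S :
  P `<=` satisfies M -> S `<=` satisfies M ->
  inst_closure P W S `<=` satisfies M.
Proof.
move=> MP MS Q; elim=> {Q} [Q /MS//|Q R I _ _ _ /MP MR QRI].
exact/satisfies_normalize/(satisfies_instance _ _ _ QRI).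
Qed.

Lemma reducts_by_sound S F :
  S `<=` satisfies M -> satisfies M F -> reducts_by S F `<=` satisfies M.
Proof.
move=> MS MF _ [Q' [Q /MS MQ QFQ'] <-].
exact/satisfies_normalize/(satisfies_reduct _ _ _ QFQ').
Qed.

(** In each reduction the reduced rule comes from [S]; the induction hypothesis supplies the truth
    of the reducing fact. *)
Lemma red_closure_sound S S1 :
  S `<=` satisfies M -> S1 `<=` satisfies M ->
  red_closure S S1 `<=` satisfies M.
Proof.
move=> MS MS1 Q; elim=> {Q} [Q /MS1//|Q F Q' _ /MS MQ _ MF QFQ'].
exact/satisfies_normalize/(satisfies_reduct _ _ _ QFQ').
Qed.

Lemma successor_sound P S F S' :
  P `<=` satisfies M -> S `<=` satisfies M -> satisfies M F ->
  successor P S F S' -> S' `<=` satisfies M.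
Proof.
(* Copied rules already belong to [S]; the three closure stages remain. *)
move=> MP MS MF [_ ->] R [|[/MS//]].
apply: inst_closure_sound => //; apply: red_closure_sound => //.
exact: reducts_by_sound.
Qed.

Lemma state_sequence_sound P D S ss :
  P `<=` satisfies M -> D `<=` satisfies M -> S `<=` satisfies M ->
  state_sequence P D (S :: ss) -> last S ss `<=` satisfies M.
Proof.
move=> MP MD; elim: ss S => [//|S' ss IHss] S MS seqS /=.
have [F /MD MF succS] := seqS 0 isT.
(* Dropping the first state shifts every index by one. *)
by apply: IHss => [|i]; [exact: successor_sound succS | exact: (seqS i.+1)].
Qed.

End Soundness.

Theorem theorem1 (Sg : signature) (P D : set (rule Sg)) (G : rule Sg)
    (c : (arity (answer Sg)).-tuple (csym Sg)) :
  program P -> database D -> P G -> goal_rule G ->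
  computed P D G (answer_fact c) ->
  logical_consequence (P `|` D) (answer_fact c).
Proof.
move=> _ _ PG _ [ss [seq_ss last_ss]] M MPD.
have MP : P `<=` satisfies M by move=> R PR; apply: MPD; left.
have MD : D `<=` satisfies M by move=> R DR; apply: MPD; right.
apply: (state_sequence_sound M _ _ _ _ MP MD _ seq_ss) last_ss.
(* The initial closure starts from the normalized goal rule alone, and [G] lies in [P]. *)
by apply: inst_closure_sound => // _ ->; exact/satisfies_normalize/MP.
Qed.
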